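(* Let $k$ be a field of characteristic zero, $P_n=k[x_1,\ldots,x_n]$, and let $\mathscr{L}_n$ be the left-symmetric algebra of all derivations of $P_n$. The right multiplication algebra $R(\mathscr{L}_n)$ of $\mathscr{L}_n$ is isomorphic to the matrix algebra $M_n(P_n)$, and there exists a unique isomorphism $\theta:R(\mathscr{L}_n)\to M_n(P_n)$ such that $\theta(R_D)=J(D)$ for all $D\in\mathscr{L}_n$.
   Context: Write $\partial_i=\partial/\partial x_i$. For an $n$-tuple $F=(f_1,\ldots,f_n)$ of elements of $P_n$ put $D_F=f_1\partial_1+\cdots+f_n\partial_n$; every $k$-linear derivation of $P_n$ equals $D_F$ for a unique $F$. $\mathscr{L}_n$ is the vector space of all $k$-linear derivations of $P_n$ with the bilinear product determined by $(a\partial_i)\cdot(b\partial_j)=\big(a\,\partial_i(b)\big)\partial_j$ for $a,b\in P_n$. The Jacobian matrix of $D=D_F$ is $J(D)=(\partial_j(f_i))_{1\le i,j\le n}\in M_n(P_n)$. For $x\in\mathscr{L}_n$, $R_x:\mathscr{L}_n\to\mathscr{L}_n$, $a\mapsto a\cdot x$, is the operator of right multiplication. $R(\mathscr{L}_n)$ is the subalgebra (with identity) of the associative algebra $\mathrm{Hom}_k(\mathscr{L}_n,\mathscr{L}_n)$ of $k$-linear maps (product: composition) generated by all $R_x$, $x\in\mathscr{L}_n$. Isomorphisms are of associative $k$-algebras. *)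

(* Defs.v *)
(* Classical axioms are needed to equip function spaces, hence derivations and
   endomorphisms, with equality, choice and module structures. *)
From HB Require Import structures.
From mathcomp Require Import all_boot all_order all_algebra.
From mathcomp Require Import boolp classical_sets functions.
From mathcomp Require Import mpoly.

Set Implicit Arguments.
Unset Strict Implicit.
Unset Printing Implicit Defensive.

Import GRing.Theory.
Local Open Scope ring_scope.

Section Derivations.
Variables (k : fieldType) (n : nat).
Local Notation P := {mpoly k[n]}.

Definition is_derivation (D : P -> P) : Prop :=
  linear D /\ forall p q, D (p * q) = D p * q + p * D q.

Definition derivation : {pred P -> P} := fun D => `[< is_derivation D >].

Lemma derivation_closed : subsemimod_closed derivation.
Proof.
split; first split.
- by apply/asboolP; split=> [c p q|p q]; rewrite /= ?scaler0 ?mul0r ?mulr0 addr0.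
- move=> D E /asboolP[Dl DM] /asboolP[El EM]; apply/asboolP.
  split=> [c p q|p q]; rewrite !addrfctE /=.
    by rewrite Dl El scalerDr addrACA.
  by rewrite DM EM mulrDl mulrDr addrACA.
- move=> c D /asboolP[Dl DM]; apply/asboolP.
  split=> [a p q|p q]; rewrite !scalrfctE.
    by rewrite Dl scalerDr !scalerA mulrC.
  by rewrite DM scalerDr scalerAl scalerAr.
Qed.

Record Der := MkDer { der_fun :> P -> P; derP : derivation der_fun }.

HB.instance Definition _ := [isSub for der_fun].
HB.instance Definition _ := [Choice of Der by <:].
HB.instance Definition _ :=
  GRing.SubChoice_isSubLmodule.Build k (P -> P) derivation Der
    derivation_closed.

Lemma der_linear (D : Der) : linear D.
Proof. by case/asboolP: (derP D). Qed.

HB.instance Definition _ (D : Der) :=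
  GRing.isLinear.Build k P P *:%R (der_fun D) (der_linear D).

Lemma derM (D : Der) p q : D (p * q) = D p * q + p * D q.
Proof. by case/asboolP: (derP D) => _; apply. Qed.

Lemma der_ext (D E : Der) : D =1 E -> D = E.
Proof. by move=> DE; apply/val_inj/funext. Qed.

Lemma derDE (D E : Der) p : (D + E) p = D p + E p. Proof. by []. Qed.
Lemma derZE c (D : Der) p : (c *: D) p = c *: D p. Proof. by []. Qed.

Fact derF_subproof (F : 'I_n -> P) :
  derivation (fun p => \sum_(i < n) F i * p^`M(i)).
Proof.
apply/asboolP; split=> [c p q|p q].
  rewrite scaler_sumr -big_split; apply: eq_bigr => i _ /=.
  by rewrite mderivD mderivZ mulrDr scalerAr.
rewrite mulr_suml mulr_sumr -big_split; apply: eq_bigr => i _ /=.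
by rewrite mderivM mulrDr !mulrA (mulrC p (F i)).
Qed.

(* D_F = f_1 d_1 + ... + f_n d_n *)
Definition derF (F : 'I_n -> P) : Der := MkDer (derF_subproof F).

Lemma derFE F p : derF F p = \sum_(i < n) F i * p^`M(i). Proof. by []. Qed.

Lemma mderivXi (i j : 'I_n) : ('X_i : P)^`M(j) = (i == j)%:R.
Proof.
rewrite mderivX mnm1E; case: eqP => [->|_]; last by rewrite scale0r.
by rewrite scale1r -{1}[U_(j)%MM]add0m addmK mpolyX0.
Qed.

(* D = D_F holds for F = (D x_1, ..., D x_n) and for no other F. *)
Lemma derFX F i : derF F 'X_i = F i.
Proof.
rewrite derFE (bigD1 i) //= mderivXi eqxx mulr1 big1 ?addr0 // => j ji.
by rewrite mderivXi eq_sym (negPf ji) mulr0.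
Qed.

Lemma der1 (D : Der) : D 1 = 0.
Proof.
by apply: (addrI (D 1)); rewrite addr0; have := derM D 1 1; rewrite !mulr1 mul1r.
Qed.

Lemma der_eqX (D E : Der) : (forall i, D 'X_i = E 'X_i) -> D = E.
Proof.
move=> DE; apply: der_ext => p; rewrite [p]mpolyE !linear_sum.
apply: eq_bigr => m _; rewrite !linearZ /=; congr (_ *: _).
rewrite mpolyXE_id; elim/big_rec: _ => [|i q _ IH]; first by rewrite !der1.
rewrite !derM IH; congr (_ * _ + _).
by elim: (m i) => [|e IHe]; rewrite ?expr0 ?der1 // !exprS !derM IHe DE.
Qed.

Lemma derF_coord (D : Der) : derF (fun i => D 'X_i) = D.
Proof. by apply: der_eqX => i; rewrite derFX. Qed.

(* a d_i *)
Definition der1F (a : P) (i : 'I_n) : Der :=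
  derF (fun j => if j == i then a else 0).

Lemma der1FE a i p : der1F a i p = a * p^`M(i).
Proof.
rewrite derFE (bigD1 i) //= eqxx big1 ?addr0 // => j /negPf->.
by rewrite mul0r.
Qed.

(* The left-symmetric product: D . D_G = D_{(D g_1, ..., D g_n)}.  The next
   lemmas show that it is the bilinear product characterised by
   (a d_i) . (b d_j) = (a d_i(b)) d_j. *)
Definition lsmul (D E : Der) : Der := derF (fun j => D (E 'X_j)).

Lemma lsmulX D E i : lsmul D E 'X_i = D (E 'X_i).
Proof. exact: derFX. Qed.

Lemma lsmul_linearl (E : Der) : linear (lsmul^~ E).
Proof.
by move=> c D D'; apply: der_eqX => i; rewrite !derDE !derZE !lsmulX !derDE !derZE.
Qed.

Lemma lsmul_linearr (D : Der) : linear (lsmul D).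
Proof.
move=> c E E'; apply: der_eqX => i.
by rewrite derDE derZE !lsmulX derDE derZE linearP.
Qed.

Lemma lsmul_der1F a i b j :
  lsmul (der1F a i) (der1F b j) = der1F (a * b^`M(i)) j.
Proof.
apply: der_eqX => l; rewrite lsmulX [LHS]der1FE !der1FE mderivXi.
case: eqP => _; first by rewrite !mulr1.
by rewrite !mulr0 mderiv0 mulr0.
Qed.

Lemma der_sum1F (D : Der) : D = \sum_(i < n) der1F (D 'X_i) i.
Proof.
have sumE (r : seq 'I_n) (G : 'I_n -> Der) p :
    (\sum_(i <- r) G i) p = \sum_(i <- r) G i p.
  by elim/big_rec2: _ => //= i q E _ <-.
apply: der_ext => p; rewrite -{1}[D]derF_coord derFE sumE.
by apply: eq_bigr => i _; rewrite der1FE.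
Qed.

Lemma lsmul_unique (mul : Der -> Der -> Der) :
  (forall E, linear (mul^~ E)) -> (forall D, linear (mul D)) ->
  (forall a i b j, mul (der1F a i) (der1F b j) = der1F (a * b^`M(i)) j) ->
  mul = lsmul.
Proof.
move=> Ml Mr M1; apply: funext => D; apply: funext => E.
have suml (m : Der -> Der -> Der) (ml : forall E, linear (m^~ E))
    (mr : forall D, linear (m D)) :
    m D E = \sum_(i < n) \sum_(j < n) m (der1F (D 'X_i) i) (der1F (E 'X_j) j).
  pose f E' : {linear Der -> Der} :=
    HB.pack (m^~ E') (GRing.isLinear.Build _ _ _ _ (m^~ E') (ml E')).
  pose g D' : {linear Der -> Der} :=
    HB.pack (m D') (GRing.isLinear.Build _ _ _ _ (m D') (mr D')).
  rewrite {1}(der_sum1F D) -[LHS]/(f E _) linear_sum; apply: eq_bigr => i _.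
  rewrite {1}(der_sum1F E) -[LHS]/(g _ (\sum_(j < n) _)) linear_sum.
  exact: eq_bigr.
rewrite (suml mul) // (suml lsmul) //; last 2 first.
- exact: lsmul_linearl.
- exact: lsmul_linearr.
apply: eq_bigr => i _; apply: eq_bigr => j _.
by rewrite M1 lsmul_der1F.
Qed.

Definition jacobian (D : Der) : 'M[P]_n := \matrix_(i, j) (D 'X_i)^`M(j).

End Derivations.

Section Endomorphisms.
Variables (k : fieldType) (V : lmodType k).

(* Hom_k(V, V), with composition as product. *)
Definition is_endo : {pred V -> V} := fun f => `[< linear f >].

Lemma is_endo_closed : subsemimod_closed is_endo.
Proof.
split; first split.
- by apply/asboolP => c u v /=; rewrite scaler0 addr0.
- move=> f g /asboolP fl /asboolP gl; apply/asboolP => c u v.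
  by rewrite !addrfctE /= fl gl scalerDr addrACA.
- move=> c f /asboolP fl; apply/asboolP => a u v.
  by rewrite !scalrfctE fl scalerDr !scalerA mulrC.
Qed.

Record endo := MkEndo { endo_fun :> V -> V; endoP : is_endo endo_fun }.

HB.instance Definition _ := [isSub for endo_fun].
HB.instance Definition _ := [Choice of endo by <:].
HB.instance Definition _ :=
  GRing.SubChoice_isSubLmodule.Build k (V -> V) is_endo endo is_endo_closed.

Lemma endo_linear (f : endo) : linear f.
Proof. by apply/asboolP; apply: endoP. Qed.

HB.instance Definition _ (f : endo) :=
  GRing.isLinear.Build k V V *:%R (endo_fun f) (endo_linear f).

Lemma endo_ext (f g : endo) : f =1 g -> f = g.
Proof. by move=> fg; apply/val_inj/funext. Qed.

Fact endo_id_subproof : is_endo idfun.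
Proof. exact/asboolP. Qed.
Definition endo_id := MkEndo endo_id_subproof.

Fact endo_comp_subproof (f g : endo) : is_endo (f \o g).
Proof. by apply/asboolP => c u v /=; rewrite !linearP. Qed.
Definition endo_comp (f g : endo) := MkEndo (endo_comp_subproof f g).

Fact endo_compA : associative endo_comp.
Proof. by move=> f g h; apply: endo_ext. Qed.
Fact endo_comp1l : left_id endo_id endo_comp.
Proof. by move=> f; apply: endo_ext. Qed.
Fact endo_comp1r : right_id endo_id endo_comp.
Proof. by move=> f; apply: endo_ext. Qed.
Fact endo_compDl : left_distributive endo_comp +%R.
Proof. by move=> f g h; apply: endo_ext. Qed.
Fact endo_compDr : right_distributive endo_comp +%R.
Proof. by move=> f g h; apply: endo_ext => v; apply: linearD. Qed.

(* Only a "pz" ring, since V may be zero. *)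
HB.instance Definition _ := GRing.Zmodule_isPzRing.Build endo
  endo_compA endo_comp1l endo_comp1r endo_compDl endo_compDr.

Lemma endo1E v : (1 : endo) v = v. Proof. by []. Qed.
Lemma endoME (f g : endo) v : (f * g) v = f (g v). Proof. by []. Qed.
Lemma endoDE (f g : endo) v : (f + g) v = f v + g v. Proof. by []. Qed.
Lemma endoZE c (f : endo) v : (c *: f) v = c *: f v. Proof. by []. Qed.

Definition unital_subalgebra (S : {pred endo}) : Prop :=
  subring_closed S /\ submod_closed S.

Definition in_generated (G : set endo) : {pred endo} :=
  fun f => `[< forall S : {pred endo},
    unital_subalgebra S -> (forall g, G g -> g \in S) -> f \in S >].

Lemma in_generated_subalgebra G : unital_subalgebra (in_generated G).
Proof.
split; split.
- by apply/asboolP => S [[S1 _ _] _] _.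
- move=> f g /asboolP Sf /asboolP Sg; apply/asboolP => S SS GS.
  by have [[_ SB _] _] := SS; apply: SB; [apply: Sf | apply: Sg].
- move=> f g /asboolP Sf /asboolP Sg; apply/asboolP => S SS GS.
  by have [[_ _ SM] _] := SS; apply: SM; [apply: Sf | apply: Sg].
- by apply/asboolP => S [_ [S0 _]] _.
- move=> c f g /asboolP Sf /asboolP Sg; apply/asboolP => S SS GS.
  by have [_ [_ SZ]] := SS; apply: SZ; [apply: Sf | apply: Sg].
Qed.

Lemma mem_generated (G : set endo) g : G g -> in_generated G g.
Proof. by move=> Gg; apply/asboolP => S _; apply. Qed.

(* The subalgebra with identity of Hom_k(V, V) generated by G. *)
Record generated (G : set endo) := MkGenerated {
  generated_endo :> endo; generatedP : in_generated G generated_endo }.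

Section GeneratedStructure.
Variable G : set endo.
HB.instance Definition _ := [isSub for @generated_endo G].
HB.instance Definition _ := [Choice of generated G by <:].
HB.instance Definition _ :=
  GRing.SubChoice_isSubPzRing.Build endo (in_generated G) (generated G)
    (in_generated_subalgebra G).1.
HB.instance Definition _ :=
  GRing.SubZmodule_isSubLmodule.Build k endo (in_generated G) (generated G)
    (GRing.submod_closed_semi (in_generated_subalgebra G).2).
End GeneratedStructure.

End Endomorphisms.

Section RightMultiplicationAlgebra.
Variables (k : fieldType) (n : nat).
Local Notation L := (Der k n).

Fact rmul_subproof (x : L) : is_endo (fun a : L => lsmul a x).
Proof. by apply/asboolP; apply: lsmul_linearl. Qed.

Definition rmul (x : L) : endo L := MkEndo (rmul_subproof x).

Definition rmul_alg := generated (range rmul).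

Definition to_rmul_alg (x : L) : rmul_alg :=
  MkGenerated (mem_generated (imageT rmul x)).

(* 'M[{mpoly k[n]}]_n is canonically a module over {mpoly k[n]}; its k-algebra
   structure is obtained by restricting scalars along the constants. *)
Definition algebra_iso (theta : rmul_alg -> 'M[{mpoly k[n]}]_n) : Prop :=
  [/\ linear_for (fun (c : k) (A : 'M[{mpoly k[n]}]_n) => c%:MP *: A) theta,
      monoid_morphism theta & bijective theta].

End RightMultiplicationAlgebra.

(* Main.v *)
Require Import Defs.
From HB Require Import structures.
From mathcomp Require Import all_boot all_order all_algebra.
From mathcomp Require Import boolp classical_sets.
From mathcomp Require Import mpoly.
Import GRing.Theory.
Local Open Scope ring_scope.

(** Identify a derivation [a] with the column of its values [a 'X_i], so that
    [Der k n] becomes the free module of columns of length [n] over the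
    polynomial ring.  The chain rule [a p = \sum_j a 'X_j * p^`M(j)], applied
    to [p = D 'X_i], says that [a . D] is the column [jacobian D] times [a]:
    right multiplication by [D] is left multiplication of columns by the
    Jacobian matrix ([mxact_jacobian]).  Let [mxact A] be the endomorphism of
    [Der k n] given by any matrix [A].  Then [mxact] is an injective morphism
    of algebras, its left inverse [endo_mx] reading off the images of the
    partial derivatives.

    Its image is exactly the right multiplication algebra.  One inclusion holds
    because the image is a subalgebra containing every [rmul D].  For the other
    ([mxact_generated]), the Jacobian matrices must generate all matrices: the
    Jacobian of [p d_i] has the gradient of [p] as its only nonzero row, the
    Jacobian of [x_l d_l] is the elementary matrix [E_ll], and their product is
    [p^`M(l) E_il].  In characteristic zero every polynomial is some [p^`M(l)]
    ([mderiv_surj]), so every multiple of every [E_il] is reached.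

    Hence [endo_mx], restricted to the right multiplication algebra, is the
    required isomorphism.  It is the only one because morphisms agreeing on
    generators agree everywhere ([generated_morph_eq]). *)

(** * Antiderivatives of polynomials *)

(** The monomial [X^m] is the derivative of [X^(m + U_i)] divided by
    [m i + 1], an integer that characteristic zero makes invertible. *)
Lemma mderiv_surj (k : fieldType) (n : nat) (i : 'I_n)
    (q : {mpoly k[n]}) :
  [pchar k] =i pred0 -> exists p : {mpoly k[n]}, p^`M(i) = q.
Proof.
move=> char0.
exists (\sum_(m <- msupp q) (q@_m / (m i).+1%:R) *: 'X_[m + U_(i)]).
rewrite [RHS]mpolyE linear_sum; apply: eq_bigr => m _ /=.
rewrite mderivZ mderivX addmK mnmDE mnm1E eqxx addn1 scalerA divfK //.
by rewrite (pcharf0P k).1.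
Qed.

(** * Subalgebras of endomorphisms *)

Section GeneratedSubalgebra.
Context {k : fieldType} {V : lmodType k}.
Implicit Types (S : {pred endo V}) (G : set (endo V)).

Lemma unital_subalgebraD S f g :
  unital_subalgebra S -> f \in S -> g \in S -> f + g \in S.
Proof. by case=> _ [_ SZ] fS gS; rewrite -[f]scale1r; apply: SZ. Qed.

(** The equalizer of two morphisms is a subalgebra.  Here it is a subset of the
    subtype [generated G], whereas the minimality of [in_generated G] speaks of
    predicates on endomorphisms; so the proof works with its image under
    [val]. *)
Lemma generated_morph_eq G (R : pzRingType) (s : k -> R -> R)
    (theta theta' : generated G -> R) :
  linear_for s theta -> monoid_morphism theta ->
  linear_for s theta' -> monoid_morphism theta' ->
  (forall x : generated G, G (val x) -> theta x = theta' x) ->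
  theta = theta'.
Proof.
move=> tl [t1 tM] t'l [t'1 t'M] eqG.
pose S : {pred endo V} := fun f =>
  `[< exists2 x : generated G, theta x = theta' x & val x = f >].
have S1 : 1 \in S by apply/asboolP; exists 1; rewrite ?t1 ?t'1.
have SM f g : f \in S -> g \in S -> f * g \in S.
  move=> /asboolP[x xE <-] /asboolP[y yE <-]; apply/asboolP.
  by exists (x * y); rewrite // tM t'M xE yE.
have SZ (c : k) f g : f \in S -> g \in S -> c *: f + g \in S.
  move=> /asboolP[x xE <-] /asboolP[y yE <-]; apply/asboolP.
  by exists (c *: x + y); rewrite // tl t'l xE yE.
(* Differences, and zero, are obtained as linear combinations: [s] is an
   arbitrary action, so additivity of the two maps is not at hand. *)
have SB f g : f \in S -> g \in S -> f - g \in S.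
  by move=> fS gS; rewrite addrC -scaleN1r; apply: SZ.
have subS : unital_subalgebra S.
  split; first by split.
  by split=> //; rewrite -(subrr (1 : endo V)); apply: SB.
apply: funext => x.
have GS g : G g -> g \in S.
  move=> Gg; apply/asboolP.
  by exists (MkGenerated (mem_generated Gg)); first exact: eqG.
have /asboolP/(_ S subS GS)/asboolP[y yE yx] := generatedP x.
by rewrite -(val_inj yx).
Qed.

End GeneratedSubalgebra.

(** * Matrices acting on derivations *)

Section MatrixAction.
Context {k : fieldType} {n : nat}.
Local Notation P := {mpoly k[n]}.
Local Notation L := (Der k n).
Implicit Types (A B : 'M[P]_n) (D a : L) (i j l : 'I_n).

Fact mxact_subproof A :
  is_endo (fun a : L => derF (fun i => \sum_j A i j * a 'X_j)).
Proof.
apply/asboolP => c a b; apply: der_eqX => i.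
rewrite derDE derZE !derFX scaler_sumr -big_split; apply: eq_bigr => j _.
by rewrite derDE derZE mulrDr scalerAr.
Qed.

Definition mxact A : endo L := MkEndo (mxact_subproof A).

Lemma mxactX A a i : mxact A a 'X_i = \sum_j A i j * a 'X_j.
Proof. exact: derFX. Qed.

Lemma mxact1 : mxact 1 = 1.
Proof.
apply: endo_ext => a; apply: der_eqX => i; rewrite mxactX endo1E (bigD1 i) //=.
rewrite mxE eqxx mul1r big1 ?addr0 // => j ji.
by rewrite mxE eq_sym (negPf ji) mul0r.
Qed.

Lemma mxactM A B : mxact (A * B) = mxact A * mxact B.
Proof.
apply: endo_ext => a; apply: der_eqX => i; rewrite endoME !mxactX.
under eq_bigr do rewrite mxE mulr_suml.
rewrite exchange_big; apply: eq_bigr => j _.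
by rewrite mxactX mulr_sumr; apply: eq_bigr => l _; rewrite mulrA.
Qed.

Lemma mxactP (c : k) A B : mxact (c%:MP *: A + B) = c *: mxact A + mxact B.
Proof.
apply: endo_ext => a; apply: der_eqX => i.
rewrite endoDE endoZE derDE derZE !mxactX scaler_sumr -big_split.
by apply: eq_bigr => j _; rewrite !mxE mulrDl -mulrA mul_mpolyC.
Qed.

Lemma mxactB A B : mxact (A - B) = mxact A - mxact B.
Proof. by rewrite addrC -scaleN1r -mpolyC1 -mpolyCN mxactP scaleN1r addrC. Qed.

Lemma mxact0 : mxact 0 = 0.
Proof. by rewrite -(subrr 0) mxactB subrr. Qed.

(** This is the chain rule: the value of [a . D] at ['X_i] is
    [a (D 'X_i)], which expands along the values [a 'X_j]. *)
Lemma mxact_jacobian D : mxact (jacobian D) = rmul D.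
Proof.
apply: endo_ext => a; apply: der_eqX => i; rewrite mxactX lsmulX.
rewrite -{2}[a]derF_coord derFE; apply: eq_bigr => j _.
by rewrite mxE mulrC.
Qed.

Definition endo_mx (f : endo L) : 'M[P]_n :=
  \matrix_(i, j) f (der1F 1 j) 'X_i.

Lemma mxactK : cancel mxact endo_mx.
Proof.
move=> A; apply/matrixP => i j; rewrite mxE mxactX (bigD1 j) //.
rewrite der1FE mderivXi eqxx !mulr1 big1 => [|l /negPf lj].
  by rewrite [LHS]addr0.
by rewrite der1FE mderivXi lj !mulr0.
Qed.

(** * The right multiplication algebra *)

Lemma generated_mxact (f : endo L) :
  in_generated (range (@rmul k n)) f -> exists A, f = mxact A.
Proof.
pose S : {pred endo L} := fun f => `[< exists A, f = mxact A >].
move=> /asboolP/(_ S) fS; apply/asboolP; apply: fS; last first.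
  move=> _ [D _ <-]; apply/asboolP.
  by exists (jacobian D); rewrite mxact_jacobian.
split; split.
- by apply/asboolP; exists 1; rewrite mxact1.
- move=> _ _ /asboolP[A ->] /asboolP[B ->].
  by apply/asboolP; exists (A - B); rewrite mxactB.
- move=> _ _ /asboolP[A ->] /asboolP[B ->].
  by apply/asboolP; exists (A * B); rewrite mxactM.
- by apply/asboolP; exists 0; rewrite mxact0.
- move=> c _ _ /asboolP[A ->] /asboolP[B ->].
  by apply/asboolP; exists (c%:MP *: A + B); rewrite mxactP.
Qed.

Lemma jacobian_der1F (p : P) i :
  jacobian (der1F p i) = \matrix_(r, j) ((r == i)%:R * p^`M(j)).
Proof.
apply/matrixP => r j; rewrite !mxE der1FE mderivXi.
by case: eqP => _; rewrite ?mulr1 ?mul1r // mulr0 mul0r mderiv0.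
Qed.

(** Multiplying by [E_ll] on the right isolates one entry of the gradient row;
    in the product below [E_ll] appears as the Jacobian of [x_l d_l]. *)
Lemma jacobian_der1FM (p : P) i l :
  jacobian (der1F p i) * jacobian (der1F 'X_l l) = p^`M(l) *: delta_mx i l.
Proof.
rewrite !jacobian_der1F; apply/matrixP => r j; rewrite !mxE (bigD1 l) //= !mxE.
rewrite big1 ?addr0; last by move=> t /negPf tl; rewrite !mxE tl mul0r mulr0.
rewrite eqxx mul1r mderivXi (eq_sym l j).
by case: (r == i); case: (j == l); rewrite /= ?mul1r ?mul0r ?mulr1 ?mulr0.
Qed.

(** The entry [A i l] has an antiderivative [p] with respect to [x_l], and the
    two Jacobians of [jacobian_der1FM] for this [p] then multiply to
    [A i l E_il]; [A] is the sum of these matrices. *)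
Lemma mxact_generated A :
  [pchar k] =i pred0 -> in_generated (range (@rmul k n)) (mxact A).
Proof.
move=> char0.
pose gen B := mxact B \in in_generated (range (@rmul k n)).
have subR := in_generated_subalgebra (range (@rmul k n)).
have [[_ _ genM] [mem0 _]] := subR.
have genJ D : gen (jacobian D).
  by rewrite /gen mxact_jacobian; apply: mem_generated; apply: imageT.
have gen0 : gen 0 by rewrite /gen mxact0.
have genD B C : gen B -> gen C -> gen (B + C).
  have := mxactP 1 B C; rewrite /gen mpolyC1 !scale1r => ->.
  exact: unital_subalgebraD.
rewrite (matrix_sum_delta A) -/(gen _).
apply: (big_ind gen) => // i _; apply: (big_ind gen) => // l _.
have [p <-] := mderiv_surj _ _ l (A i l) char0.
by rewrite /gen -jacobian_der1FM mxactM; apply: genM; apply: genJ.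
Qed.

(** Together with [mxactK], this makes [endo_mx] the inverse of [mxact] on the
    right multiplication algebra, so it inherits multiplicativity and linearity
    from [mxact]. *)
Lemma rmul_alg_endo_mxK (f : rmul_alg k n) : mxact (endo_mx (val f)) = val f.
Proof.
by have [A fA] := generated_mxact _ (generatedP f); rewrite [val f]fA mxactK.
Qed.

Lemma endo_mx_algebra_iso :
  [pchar k] =i pred0 -> algebra_iso (fun f : rmul_alg k n => endo_mx (val f)).
Proof.
move=> char0; split.
- move=> c f g; apply: (can_inj mxactK).
  by rewrite mxactP !rmul_alg_endo_mxK.
- split=> [|f g]; apply: (can_inj mxactK).
    by rewrite mxact1 rmul_alg_endo_mxK.
  by rewrite mxactM !rmul_alg_endo_mxK.
- exists (fun A => MkGenerated (mxact_generated A char0)) => [f|A].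
    by apply: val_inj; rewrite /= rmul_alg_endo_mxK.
  exact: mxactK.
Qed.

End MatrixAction.

Theorem lemma4 (k : fieldType) (n : nat) (char0 : [pchar k] =i pred0) :
  (exists theta : rmul_alg k n -> 'M[{mpoly k[n]}]_n, algebra_iso theta) /\
  (exists! theta : rmul_alg k n -> 'M[{mpoly k[n]}]_n,
     algebra_iso theta /\
     forall D : Der k n, theta (to_rmul_alg D) = jacobian D).
Proof.
have iso := @endo_mx_algebra_iso k n char0.
split; first by eexists; exact: iso.
exists (fun f => endo_mx (val f)); split=> [|theta [[tl tM _] tJ]].
  by split=> // D; rewrite /= -mxact_jacobian mxactK.
have [el eM _] := iso.
apply: (generated_morph_eq _ _ _ _ _ el eM tl tM) => f [D _ Df].
have -> : f = to_rmul_alg D by apply: val_inj; rewrite -Df.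
by rewrite tJ /= -mxact_jacobian mxactK.
Qed.
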